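(* Let $(K,T,+,;,{}^*,\rightarrow,0,1)$ be an idempotent graded Kleene algebra with tests (I-GKAT). Then for all $b,c\in T$ and $p\in K$: if $b;c;p\leq b;c;p;c$, then $c;(b;p)^*;(b\rightarrow 0)\leq c;(b;p)^*;(b\rightarrow 0);(b\rightarrow 0);c$.
   Context: A graded Kleene algebra with tests (GKAT) is a tuple $(K,T,+,;,{}^*,\rightarrow,0,1)$ where $K$ is a set, $T\subseteq K$, $0,1\in T$, $+$ and $;$ are binary operations on $K$ under which $T$ is closed, ${}^*$ is a unary operation on $K$, and $\rightarrow$ is a binary operation on $T$ with values in $T$, such that for all $p,q,r\in K$ and $a,b,c\in T$: $p+(q+r)=(p+q)+r$; $p+q=q+p$; $p;(q;r)=(p;q);r$; $p;1=1;p=p$; $p;(q+r)=p;q+p;r$; $(p+q);r=p;r+q;r$; $p;0=0;p=0$; $1+p;p^*=p^*$; $q+p;r\leq r\Rightarrow p^*;q\leq r$; $q+r;p\leq r\Rightarrow q;p^*\leq r$; $a;b\leq c\Leftrightarrow b\leq a\rightarrow c$; $a\leq 1$; $a;b=b;a$. Here $p\leq q$ means $p+q=q$, and $;$ binds more tightly than $+$. An idempotent GKAT (I-GKAT) is a GKAT that additionally satisfies $a;a=a$ for all $a\in T$. *)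

(* Defs.v *)
Declare Scope gkat_scope.
Delimit Scope gkat_scope with gkat.

(* The tuple (K, T, +, ;, *, ->, 0, 1), before any equational axiom.  The
   residual -> is only defined on T, so its type is over the subtype
   {a | T a}. *)
Record gkatSig : Type := GkatSig {
  carrier : Type;
  test : carrier -> Prop;
  add : carrier -> carrier -> carrier;
  mul : carrier -> carrier -> carrier;
  star : carrier -> carrier;
  imp : {a : carrier | test a} -> {a : carrier | test a} ->
        {a : carrier | test a};
  zero : carrier;
  one : carrier;
  test_add : forall a b : carrier, test a -> test b -> test (add a b);
  test_mul : forall a b : carrier, test a -> test b -> test (mul a b);
  test_zero : test zero;
  test_one : test one
}.

Arguments add {g}.
Arguments mul {g}.
Arguments star {g}.
Arguments imp {g}.
Arguments zero {g}.
Arguments one {g}.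

Definition tests (G : gkatSig) : Type := {a : carrier G | test G a}.

Definition test_val (G : gkatSig) (a : tests G) : carrier G := proj1_sig a.

Coercion carrier : gkatSig >-> Sortclass.
Coercion test_val : tests >-> carrier.

Definition zeroT {G : gkatSig} : tests G := exist _ zero (test_zero G).

Definition impT {G : gkatSig} (a b : tests G) : tests G := imp a b.

Definition le {G : gkatSig} (p q : G) : Prop := add p q = q.

Notation "p + q" := (add p q) (at level 50, left associativity) : gkat_scope.
Notation "p ;; q" := (mul p q) (at level 40, left associativity) : gkat_scope.
Notation "p ^*" := (star p) (at level 2, format "p ^*") : gkat_scope.
Notation "a ~> b" := (impT a b) (at level 55, no associativity) : gkat_scope.
Notation "p <= q" := (le p q) (at level 70, no associativity) : gkat_scope.
Notation "0" := zero : gkat_scope.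
Notation "1" := one : gkat_scope.

Local Open Scope gkat_scope.

(* p + p = p and p + 0 = p are not listed: they follow from a <= 1 at
   a = 1 and a = 0 by distributivity. *)
Record is_gkat (G : gkatSig) : Prop := IsGkat {
  addA : forall p q r : G, p + (q + r) = (p + q) + r;
  addC : forall p q : G, p + q = q + p;
  mulA : forall p q r : G, p ;; (q ;; r) = (p ;; q) ;; r;
  mul_oner : forall p : G, p ;; 1 = p;
  mul_onel : forall p : G, 1 ;; p = p;
  mulDr : forall p q r : G, p ;; (q + r) = p ;; q + p ;; r;
  mulDl : forall p q r : G, (p + q) ;; r = p ;; r + q ;; r;
  mul_zeror : forall p : G, p ;; 0 = 0;
  mul_zerol : forall p : G, 0 ;; p = 0;
  star_unfold : forall p : G, 1 + p ;; p^* = p^*;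
  star_indl : forall p q r : G, q + p ;; r <= r -> p^* ;; q <= r;
  star_indr : forall p q r : G, q + r ;; p <= r -> q ;; p^* <= r;
  imp_adj : forall a b c : tests G, a ;; b <= c <-> b <= a ~> c;
  test_le1 : forall a : tests G, a <= 1;
  test_mulC : forall a b : tests G, a ;; b = b ;; a
}.

Record is_igkat (G : gkatSig) : Prop := IsIgkat {
  igkat_gkat : is_gkat G;
  test_mulI : forall a : tests G, a ;; a = a
}.

(* Main.v *)
(* Since c;b;p = b;c;p <= b;c;p;c, the test c is an invariant of the loop body,
   so star induction gives c;(b;p)^* <= c;(b;p)^*;c; it remains to multiply by
   b ~> 0, which commutes with c and is idempotent. *)
From Stdlib Require Import Setoid.
Require Import Defs.
Local Open Scope gkat_scope.

Section GkatTheory.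

Context {G : gkatSig} (HG : is_gkat G).

Lemma add_idem (p : G) : p + p = p.
Proof.
  assert (H11 : (1 + 1 : G) = 1) by exact (test_le1 G HG (exist _ 1 (test_one G))).
  rewrite <- (mul_oner G HG p) at 1 2.
  now rewrite <- (mulDr G HG), H11, (mul_oner G HG).
Qed.

Lemma le_refl (p : G) : p <= p.
Proof. exact (add_idem p). Qed.

Lemma le_trans (p q r : G) : p <= q -> q <= r -> p <= r.
Proof.
  unfold le; intros Hpq Hqr.
  now rewrite <- Hqr, (addA G HG), Hpq.
Qed.

Lemma le_addl (p q : G) : p <= p + q.
Proof. unfold le; now rewrite (addA G HG), add_idem. Qed.

Lemma le_addr (p q : G) : q <= p + q.
Proof. rewrite (addC G HG); apply le_addl. Qed.

Lemma add_lub (p q r : G) : p <= r -> q <= r -> p + q <= r.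
Proof.
  unfold le; intros Hp Hq.
  now rewrite <- (addA G HG), Hq.
Qed.

Lemma mul_monor (p q r : G) : q <= r -> p ;; q <= p ;; r.
Proof. unfold le; intros H; now rewrite <- (mulDr G HG), H. Qed.

Lemma mul_monol (p q r : G) : p <= q -> p ;; r <= q ;; r.
Proof. unfold le; intros H; now rewrite <- (mulDl G HG), H. Qed.

Lemma one_le_star (p : G) : 1 <= p^*.
Proof. rewrite <- (star_unfold G HG); apply le_addl. Qed.

Lemma mul_star_le (p : G) : p ;; p^* <= p^*.
Proof. rewrite <- (star_unfold G HG p) at 2; apply le_addr. Qed.

(** [star_unfold] peels an iteration off on the left only; left induction with [p^*] as the bound
    supplies the right-hand version. *)
Lemma star_mul_le (p : G) : p^* ;; p <= p^*.
Proof.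
  apply (star_indl G HG), add_lub.
  - apply le_trans with (p ;; p^*).
    + rewrite <- (mul_oner G HG p) at 1; apply mul_monor, one_le_star.
    + apply mul_star_le.
  - apply mul_star_le.
Qed.

(** Right induction with bound [c ;; q^* ;; c]: it dominates [c] and absorbs a further [q] on the
    right. *)
Lemma star_invariant (c q : G) :
  c <= 1 -> c ;; c = c -> c ;; q <= c ;; q ;; c ->
  c ;; q^* <= c ;; q^* ;; c.
Proof.
  intros Hc1 Hcc Hinv.
  apply (star_indr G HG), add_lub.
  (* Zero iterations: [c = c ;; c = c ;; 1 ;; c], and [1 <= q^*]. *)
  - rewrite <- Hcc at 1.
    apply mul_monol.
    rewrite <- (mul_oner G HG c) at 1.
    apply mul_monor, one_le_star.
  - apply le_trans with (c ;; q^* ;; (q ;; c)).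
    + rewrite <- (mulA G HG (c ;; q^*)).
      apply mul_monor.
      (* Dropping the left [c <= 1] from [c ;; q ;; c] turns invariance into [c ;; q <= q ;; c], so
         the last [c] moves past [q]. *)
      apply le_trans with (c ;; q ;; c); [exact Hinv |].
      rewrite <- (mulA G HG).
      rewrite <- (mul_onel G HG (q ;; c)) at 2.
      apply mul_monol, Hc1.
    + rewrite (mulA G HG).
      apply mul_monol.
      rewrite <- (mulA G HG).
      apply mul_monor, star_mul_le.
Qed.

End GkatTheory.

Theorem theorem2 (G : gkatSig) (HG : is_igkat G) (b c : tests G) (p : G) :
  b ;; c ;; p <= b ;; c ;; p ;; c ->
  c ;; (b ;; p)^* ;; (b ~> zeroT) <=
    c ;; (b ;; p)^* ;; (b ~> zeroT) ;; (b ~> zeroT) ;; c.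
Proof.
  destruct HG as [HG mulI]; intros Hinv.
  set (n := b ~> zeroT).
  (* This is the premise of [star_invariant] for [q := b ;; p]. *)
  rewrite (test_mulC G HG b c), <- (mulA G HG c b p) in Hinv.
  (* The tail [n ;; n ;; c] becomes [c ;; n], so both sides end in [n], which monotonicity
     strips. *)
  rewrite <- (mulA G HG _ n n), mulI, <- (mulA G HG _ n c), (test_mulC G HG n c),
    (mulA G HG).
  apply (mul_monol HG), (star_invariant HG).
  - apply (test_le1 G HG).
  - apply mulI.
  - exact Hinv.
Qed.
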